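(* Let $a,b,c,d,e,f,k,l,p,q,r,s\ge0$ be integers with $a+b$, $c+d$, $e+f$, $k+l$, $p+q$, $r+s$ positive, and let $$E=\begin{bmatrix} J_{k,a}&-J_{k,b}&J_{k,c}&-J_{k,d}&0&0\\ -J_{l,a}&J_{l,b}&-J_{l,c}&J_{l,d}&0&0\\ J_{p,a}&-J_{p,b}&0&0&J_{p,e}&-J_{p,f}\\ -J_{q,a}&J_{q,b}&0&0&-J_{q,e}&J_{q,f}\\ 0&0&J_{r,c}&-J_{r,d}&-J_{r,e}&J_{r,f}\\ 0&0&-J_{s,c}&J_{s,d}&J_{s,e}&-J_{s,f} \end{bmatrix}$$ be realizable, with $E\mathbf 1=0$ and $\mathbf 1^TE=0^T$. Let $$A=\begin{bmatrix} 0&J_{k,b}&0&J_{k,d}&X_{11}&X_{12}\\ J_{l,a}&0&J_{l,c}&0&X_{21}&X_{22}\\ 0&J_{p,b}&Y_{11}&Y_{12}&0&J_{p,f}\\ J_{q,a}&0&Y_{21}&Y_{22}&J_{q,e}&0\\ Z_{11}&Z_{12}&0&J_{r,d}&J_{r,e}&0\\ Z_{21}&Z_{22}&J_{s,c}&0&0&J_{s,f} \end{bmatrix}$$ be a $(0,1)$ matrix conformally partitioned with $E$ such that $A$ and $A+E$ are Gram mates. Then $A$ and $A+E$ are convertible if and only if one of the following holds: (i) $X_{i1}\mathbf 1_e-X_{i2}\mathbf 1_f=\frac{e-f}{2}\mathbf 1$ for $i=1,2$; (ii) $X_{1i}^T\mathbf 1_k-X_{2i}^T\mathbf 1_l=\frac{k-l}{2}\mathbf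 1$ for $i=1,2$; (iii) $Y_{i1}\mathbf 1_c-Y_{i2}\mathbf 1_d=\frac{c-d}{2}\mathbf 1$ for $i=1,2$; (iv) $Y_{1i}^T\mathbf 1_p-Y_{2i}^T\mathbf 1_q=\frac{p-q}{2}\mathbf 1$ for $i=1,2$; (v) $Z_{i1}\mathbf 1_a-Z_{i2}\mathbf 1_b=\frac{a-b}{2}\mathbf 1$ for $i=1,2$; (vi) $Z_{1i}^T\mathbf 1_r-Z_{2i}^T\mathbf 1_s=\frac{r-s}{2}\mathbf 1$ for $i=1,2$. Furthermore, if $A$ is convertible to $A+E$, then the Gram singular values of $A$ and $A+E$ are the square roots of the eigenvalues $\lambda$ of $$M=\begin{bmatrix} l(a+c)+\frac12s(c+d)+\frac14(k-l)(a+b) & \frac12l(a+b)-\frac12s(e+f)+\frac12(k-l)(a+e)\\ \frac12q(a+b)-\frac12r(c+d)+\frac12(p-q)(a+c) & q(a+e)+\frac12r(e+f)+\frac14(p-q)(a+b) \end{bmatrix},$$ and a right singular vector associated with $\sqrt\lambda$ is the normalization of $\zeta_1\mathbf x_1+\zeta_2\mathbf x_2$, where $\mathbf x_1^T=[\mathbf 1_a^T,-\mathbf 1_b^T,\mathbf 1_c^T,-\mathbf 1_d^T,\mathbf 0_e^T,\mathbf 0_f^T]$, $\mathbf x_2^T=[\mathbf 1_a^T,-\mathbf 1_b^T,\mathbf 0_c^T,\mathbf 0_d^T,\mathbf 1_e^T,-\mathbf 1_f^T]$ and $(\zeta_1,\zeta_2)$ is an eigenvector of $M$ associated with $\lamb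da$.
   Context: $J_{p,q}$ is the $p\times q$ all-ones matrix; $\mathbf 1_p,\mathbf 0_p$ all-ones and all-zeros vectors. Two $(0,1)$ matrices are Gram mates if $AA^T=BB^T$, $A^TA=B^TB$, $A\neq B$. A $(0,1,-1)$ matrix $E$ with zero row and column sums is realizable if some $(0,1)$ $A$ makes $A$, $A+E$ Gram mates. $A$ and $B$ are convertible if there are orthogonal $U,V$ and rectangular diagonal $\Sigma\ge0$ with $A=U\Sigma V^T$ and a diagonal $\pm1$ matrix $S$ with $k\ge1$ entries $-1$, all at positions $i$ with $\Sigma_{ii}>0$, such that $B=US\Sigma V^T$; the $\Sigma_{ii}$ at positions with $S_{ii}=-1$ are the Gram singular values of $A,B$, and the corresponding columns of $V$ are the corresponding right singular vectors. *)

(* Defs.v *)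
From HB Require Import structures.
From mathcomp Require Import all_boot all_order all_algebra.
From mathcomp Require Import reals.
Set Implicit Arguments.
Unset Strict Implicit.
Unset Printing Implicit Defensive.
Import Order.TTheory GRing.Theory Num.Theory.
Local Open Scope ring_scope.

Section Defs.
Variable R : realType.

Definition is01 m n (A : 'M[R]_(m, n)) : Prop :=
  forall i j, A i j = 0 \/ A i j = 1.

Definition Jmx p q : 'M[R]_(p, q) := const_mx 1.

Definition gram_mates m n (A B : 'M[R]_(m, n)) : Prop :=
  [/\ is01 A, is01 B, A *m A^T = B *m B^T, A^T *m A = B^T *m B & A <> B].

Definition realizable m n (E : 'M[R]_(m, n)) : Prop :=
  [/\ (forall i j, E i j = 0 \/ E i j = 1 \/ E i j = -1),
      E *m const_mx 1 = 0 :> 'cV_m,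
      const_mx 1 *m E = 0 :> 'rV_n &
      exists A : 'M[R]_(m, n), is01 A /\ gram_mates A (A + E)].

Definition orthogonalmx n (U : 'M[R]_n) : Prop := U *m U^T = 1%:M.

Definition conv_data m n (A B : 'M[R]_(m, n)) (U : 'M[R]_m) (V : 'M[R]_n)
    (Sg : 'M[R]_(m, n)) (S : 'M[R]_m) : Prop :=
  [/\ orthogonalmx U /\ orthogonalmx V,
      (forall (i : 'I_m) (j : 'I_n), (i : nat) <> j -> Sg i j = 0) /\ (forall i j, 0 <= Sg i j),
      A = U *m Sg *m V^T,
      [/\ (forall i j, i <> j -> S i j = 0),
          (forall i, S i i = 1 \/ S i i = -1),
          (exists i, S i i = -1) &
          (forall i, S i i = -1 -> exists j : 'I_n, (j : nat) = i /\ 0 < Sg i j)]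
    & B = U *m S *m Sg *m V^T].

Definition convertible m n (A B : 'M[R]_(m, n)) : Prop :=
  exists U V Sg S, @conv_data m n A B U V Sg S.

Definition eigenpair n (M : 'M[R]_n) (lam : R) (z : 'cV[R]_n) : Prop :=
  z != 0 /\ M *m z = lam *: z.

Definition eigenval n (M : 'M[R]_n) (lam : R) : Prop :=
  exists z, eigenpair M lam z.

Definition normalize n (v : 'cV[R]_n) : 'cV[R]_n :=
  (Num.sqrt (\sum_i v i ord0 ^+ 2))^-1 *: v.

Definition row6 m n1 n2 n3 n4 n5 n6 (B1 : 'M[R]_(m, n1)) (B2 : 'M[R]_(m, n2))
  (B3 : 'M[R]_(m, n3)) (B4 : 'M[R]_(m, n4)) (B5 : 'M[R]_(m, n5))
  (B6 : 'M[R]_(m, n6)) : 'M[R]_(m, n1 + (n2 + (n3 + (n4 + (n5 + n6))))) :=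
  row_mx B1 (row_mx B2 (row_mx B3 (row_mx B4 (row_mx B5 B6)))).

Definition col6 n m1 m2 m3 m4 m5 m6 (B1 : 'M[R]_(m1, n)) (B2 : 'M[R]_(m2, n))
  (B3 : 'M[R]_(m3, n)) (B4 : 'M[R]_(m4, n)) (B5 : 'M[R]_(m5, n))
  (B6 : 'M[R]_(m6, n)) : 'M[R]_(m1 + (m2 + (m3 + (m4 + (m5 + m6)))), n) :=
  col_mx B1 (col_mx B2 (col_mx B3 (col_mx B4 (col_mx B5 B6)))).

Definition Emat (a b c d e f k l p q r s : nat) :=
  col6
   (row6 (Jmx k a) (- Jmx k b) (Jmx k c) (- Jmx k d) 0 0)
   (row6 (- Jmx l a) (Jmx l b) (- Jmx l c) (Jmx l d) 0 0)
   (row6 (Jmx p a) (- Jmx p b) 0 0 (Jmx p e) (- Jmx p f))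
   (row6 (- Jmx q a) (Jmx q b) 0 0 (- Jmx q e) (Jmx q f))
   (row6 0 0 (Jmx r c) (- Jmx r d) (- Jmx r e) (Jmx r f))
   (row6 0 0 (- Jmx s c) (Jmx s d) (Jmx s e) (- Jmx s f)).

Definition Amat (a b c d e f k l p q r s : nat)
  (X11 : 'M[R]_(k, e)) (X12 : 'M[R]_(k, f)) (X21 : 'M[R]_(l, e)) (X22 : 'M[R]_(l, f))
  (Y11 : 'M[R]_(p, c)) (Y12 : 'M[R]_(p, d)) (Y21 : 'M[R]_(q, c)) (Y22 : 'M[R]_(q, d))
  (Z11 : 'M[R]_(r, a)) (Z12 : 'M[R]_(r, b)) (Z21 : 'M[R]_(s, a)) (Z22 : 'M[R]_(s, b)) :=
  col6
   (row6 0 (Jmx k b) 0 (Jmx k d) X11 X12)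
   (row6 (Jmx l a) 0 (Jmx l c) 0 X21 X22)
   (row6 0 (Jmx p b) Y11 Y12 0 (Jmx p f))
   (row6 (Jmx q a) 0 Y21 Y22 (Jmx q e) 0)
   (row6 Z11 Z12 0 (Jmx r d) (Jmx r e) 0)
   (row6 Z21 Z22 (Jmx s c) 0 0 (Jmx s f)).

Definition xvec1 (a b c d e f : nat) :=
  col6 (Jmx a 1) (- Jmx b 1) (Jmx c 1) (- Jmx d 1) (0 : 'cV[R]_e) (0 : 'cV[R]_f).
Definition xvec2 (a b c d e f : nat) :=
  col6 (Jmx a 1) (- Jmx b 1) (0 : 'cV[R]_c) (0 : 'cV[R]_d) (Jmx e 1) (- Jmx f 1).

Definition Mmat (a b c d e f k l p q r s : nat) : 'M[R]_2 :=
  let N (x : nat) : R := x%:R in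
  let m11 := N l * (N a + N c) + 2^-1 * N s * (N c + N d)
             + 4^-1 * (N k - N l) * (N a + N b) in
  let m12 := 2^-1 * N l * (N a + N b) - 2^-1 * N s * (N e + N f)
             + 2^-1 * (N k - N l) * (N a + N e) in
  let m21 := 2^-1 * N q * (N a + N b) - 2^-1 * N r * (N c + N d)
             + 2^-1 * (N p - N q) * (N a + N c) in
  let m22 := N q * (N a + N e) + 2^-1 * N r * (N e + N f)
             + 4^-1 * (N p - N q) * (N a + N b) in
  \matrix_(i < 2, j < 2)
    if (i : nat) == 0%N then (if (j : nat) == 0%N then m11 else m12)
    else (if (j : nat) == 0%N then m21 else m22).

End Defs.

(* Main.v *)
Require Import Defs.
From HB Require Import structures.
From mathcomp Require Import all_boot all_order all_algebra.
From mathcomp Require Import reals.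
From mathcomp Require Import complex spectral ring lra.
Import Order.TTheory GRing.Theory Num.Theory.
Local Open Scope ring_scope.

(** Put [C = A + (A + E)]. Being Gram mates means that [C E^T] and [C^T E] are
    skew-symmetric, and being convertible means that both vanish: the matrices
    [E] and [C] then have orthogonal row spaces and orthogonal column spaces, so
    that singular value decompositions of the two can be carried out in one common
    pair of orthogonal bases, and [A = (C - E) / 2], [A + E = (C + E) / 2] differ
    exactly by the signs of the singular values coming from [E]. A skew matrix
    [W = C^T E] satisfies [W^T W = - C^T (E C^T) E], so each of the two products
    vanishes as soon as the other one does.

    Here [E = y1 x1^T + y2 x2^T] has rank two, hence skewness forces
    [C x1 = - t y2] and [C x2 = t y1] for a scalar [t]. Reading these equations on
    the block rows shows that each of (i), (iii), (v) says [t = 0]; the family of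
    block patterns is stable under transposition, which gives (vi), (iv), (ii).

    The Gram singular values are the nonzero singular values of [E / 2], and
    [M = (Y^T Y) (X^T X) / 4] is the matrix of [E^T E / 4] in the basis [x1, x2]
    of the row space of [E = Y X^T]. *)

Set Implicit Arguments.
Unset Strict Implicit.
Unset Printing Implicit Defensive.

(** * The standard inner product on real column vectors *)

Section SimultaneousSVD.
Variable R : realType.

Definition dot n (u v : 'cV[R]_n) : R := (u^T *m v) 0 0.

Lemma dotE n (u v : 'cV[R]_n) : dot u v = \sum_i u i 0 * v i 0.
Proof. by rewrite /dot mxE; apply: eq_bigr => i _; rewrite mxE. Qed.

Lemma mul_trmx_dot n (u v : 'cV[R]_n) : u^T *m v = (dot u v)%:M.
Proof. exact: mx11_scalar. Qed.

Lemma dotC n (u v : 'cV[R]_n) : dot u v = dot v u.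
Proof. by rewrite !dotE; apply: eq_bigr => i _; rewrite mulrC. Qed.

Lemma dotDr n (u v w : 'cV[R]_n) : dot u (v + w) = dot u v + dot u w.
Proof. by rewrite /dot mulmxDr mxE. Qed.

Lemma dotZr n x (u v : 'cV[R]_n) : dot u (x *: v) = x * dot u v.
Proof. by rewrite /dot -scalemxAr mxE. Qed.

Lemma dotZl n x (u v : 'cV[R]_n) : dot (x *: u) v = x * dot u v.
Proof. by rewrite dotC dotZr dotC. Qed.

Lemma dotBr n (u v w : 'cV[R]_n) : dot u (v - w) = dot u v - dot u w.
Proof. by rewrite -scaleN1r dotDr dotZr mulN1r. Qed.

Lemma dotBl n (u v w : 'cV[R]_n) : dot (u - v) w = dot u w - dot v w.
Proof. by rewrite dotC dotBr !(dotC w). Qed.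

Lemma dot_mulmx m n (P : 'M[R]_(m, n)) (u : 'cV_m) (v : 'cV_n) :
  dot u (P *m v) = dot (P^T *m u) v.
Proof. by rewrite /dot trmx_mul trmxK mulmxA. Qed.

Lemma dot_ge0 n (u : 'cV[R]_n) : 0 <= dot u u.
Proof. by rewrite dotE; apply: sumr_ge0 => i _; rewrite -expr2 sqr_ge0. Qed.

Lemma dot_eq0 n (u : 'cV[R]_n) : (dot u u == 0) = (u == 0).
Proof.
apply/eqP/eqP => [|->]; last by rewrite /dot mulmx0 mxE.
rewrite dotE => /eqP; rewrite psumr_eq0 => [|i _]; last by rewrite -expr2 sqr_ge0.
move=> /allP u0; apply/matrixP => i j; rewrite mxE ord1.
by move: (u0 i (mem_index_enum i)); rewrite -expr2 sqrf_eq0 => /eqP.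
Qed.

Lemma dot_gt0 n (u : 'cV[R]_n) : (0 < dot u u) = (u != 0).
Proof. by rewrite lt0r dot_ge0 andbT dot_eq0. Qed.

Lemma trmx_mul_eq0 m n (P : 'M[R]_(m, n)) : P^T *m P = 0 -> P = 0.
Proof.
move=> P0; apply/matrixP => i j; rewrite [RHS]mxE.
have /eqP : dot (col j P) (col j P) = (P^T *m P) j j.
  by rewrite dotE mxE; apply: eq_bigr => l _; rewrite !mxE.
by rewrite P0 mxE dot_eq0 => /eqP/matrixP/(_ i 0); rewrite !mxE.
Qed.

(** The spectral theorem over the complex numbers diagonalizes [N] with a real spectrum. As [N] is
    nonzero, some diagonal entry is nonzero, and it is the eigenvalue sought. *)
Lemma symmetric_eigenvector_neq0 n (N : 'M[R]_n) : N^T = N -> N != 0 ->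
  exists x (v : 'cV_n), [/\ x != 0, v != 0 & N *m v = x *: v].
Proof.
move=> Nsym N0; pose f := real_complex R; pose NC := map_mx f N.
have NCsym : NC \is symmetricmx.
  by apply/is_hermitianmxP; rewrite expr0 scale1r map_mx_id // /NC map_trmx Nsym.
have NCreal : NC \is a realmx.
  by apply/mxOverP => i j; rewrite mxE; apply/complex_realP; exists (N i j).
have /orthomx_spectralP NCE := symmetric_normalmx NCsym NCreal.
have spR := hermitian_spectral_diag_real (realsym_hermsym NCsym NCreal).
move: NCE spR (spectral_unit NC).
set P := spectralmx NC; set sp := spectral_diag NC => NCE spR Pu.
have sp0 : sp != 0.
  apply: contra N0 => /eqP sp0; apply/eqP/matrixP => i j.
  have /matrixP/(_ i j) : NC = 0 by rewrite NCE sp0 linear0 mulmx0 mul0mx.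
  by rewrite !mxE => /complexI.
have [i spi] : exists i, sp 0 i != 0.
  apply/existsP; apply: contraNT sp0 => /existsPn sp0.
  by apply/eqP/rowP => i; rewrite mxE; apply/eqP; have := sp0 i; rewrite negbK.
have /complex_realP [x spE] := mxOverP spR 0 i.
have x0 : x != 0 by apply: contra spi => /eqP x0; rewrite spE x0.
have : eigenvalue NC (f x).
  apply/eigenvalueP; exists (row i P).
    rewrite -row_mul NCE !mulmxA mulmxV // mul1mx row_mul.
    by rewrite row_diag_mx spE -scalemxAl -rowE.
  apply/negP => /eqP r0; have : row i (P *m invmx P) = 0 by rewrite row_mul r0 mul0mx.
  rewrite mulmxV // => /rowP/(_ i); rewrite !mxE eqxx => /eqP; apply/negP; exact: oner_neq0.
(* The eigenvector found so far may be complex. Being a root of the characteristic polynomial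
   descends along the embedding of the reals, which yields a real left eigenvector; symmetry of [N]
   turns it into a right one. *)
rewrite eigenvalue_root_char -map_char_poly fmorph_root -eigenvalue_root_char.
move=> /eigenvalueP [v vN v0]; exists x, v^T; split => //.
  by rewrite -trmx0 (inj_eq trmx_inj).
by rewrite -linearZ /= -vN trmx_mul Nsym.
Qed.

(** * Householder reflections *)

(* For [h = 0] the scalar [2 / dot h h] is [0] and [reflection h] is the identity. *)
Definition reflection n (h : 'cV[R]_n) : 'M[R]_n :=
  1%:M - (2 / dot h h) *: (h *m h^T).

Lemma reflection_tr n (h : 'cV[R]_n) : (reflection h)^T = reflection h.
Proof. by rewrite /reflection linearB linearZ /= trmx1 trmx_mul trmxK. Qed.

Lemma reflection_mulv n (h v : 'cV[R]_n) :
  reflection h *m v = v - (2 / dot h h * dot h v) *: h.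
Proof.
rewrite /reflection mulmxBl mul1mx -scalemxAl -mulmxA mul_trmx_dot.
by rewrite mul_mx_scalar scalerA.
Qed.

Lemma reflection_neg n (h : 'cV[R]_n) : reflection h *m h = - h.
Proof.
rewrite reflection_mulv; have [->|h0] := eqVneq h 0.
  by rewrite scaler0 subr0 oppr0.
by rewrite divfK ?dot_eq0 // scaler_nat mulr2n opprD addrA subrr sub0r.
Qed.

Lemma reflection_invol n (h : 'cV[R]_n) : reflection h *m reflection h = 1%:M.
Proof.
rewrite {2}/reflection mulmxBr mulmx1 -scalemxAr mulmxA reflection_neg.
by rewrite mulNmx scalerN opprK subrK.
Qed.

(** For unit vectors, [h = e - u] satisfies [dot h h = 2 * dot h e], so the multiple of [h]
    subtracted from [e] is [h] itself. *)
Lemma reflection_swap n (e u : 'cV[R]_n) : dot e e = 1 -> dot u u = 1 ->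
  reflection (e - u) *m e = u.
Proof.
move=> e1 u1; rewrite reflection_mulv.
have [eu|eu] := eqVneq (e - u) 0.
  by rewrite eu scaler0 subr0; apply/eqP; rewrite -subr_eq0 eu.
have hh : dot (e - u) (e - u) = 2 * dot (e - u) e.
  by rewrite dotBr !dotBl e1 u1 (dotC u e); ring.
have h0 : dot (e - u) e != 0.
  by apply: contra eu => /eqP h0; rewrite -dot_eq0 hh h0 mulr0.
by rewrite hh invfM mulrA mulfV ?pnatr_eq0 // mul1r mulVf // scale1r opprB addrC subrK.
Qed.

(** * Simultaneous singular value decompositions with signs *)

(** This is [conv_data] without the demand for at least one entry -1; that demand would not survive
    an induction that ends in zero or empty matrices. *)
Definition signed_svd m n (F G : 'M[R]_(m, n)) (U : 'M[R]_m) (V : 'M[R]_n)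
    (Sg : 'M[R]_(m, n)) (S : 'M[R]_m) : Prop :=
  [/\ orthogonalmx U /\ orthogonalmx V,
      (forall (i : 'I_m) (j : 'I_n), (i : nat) <> j -> Sg i j = 0) /\ (forall i j, 0 <= Sg i j),
      F = U *m Sg *m V^T,
      [/\ (forall i j, i <> j -> S i j = 0),
          (forall i, S i i = 1 \/ S i i = -1) &
          (forall i, S i i = -1 -> exists j : 'I_n, (j : nat) = i /\ 0 < Sg i j)]
    & G = U *m S *m Sg *m V^T].

(** The two equations say that [F - G] and [F + G] have orthogonal column spaces and orthogonal row
    spaces. *)
Definition orthogonal_sum_diff m n (F G : 'M[R]_(m, n)) : Prop :=
  (F - G)^T *m (F + G) = 0 /\ (F - G) *m (F + G)^T = 0.

Lemma block_mx_singular m n (F : 'M[R]_(1 + m, 1 + n)) x :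
  F *m delta_mx 0 0 = x *: (delta_mx 0 0 : 'cV_(1 + m)) ->
  F^T *m delta_mx 0 0 = x *: (delta_mx 0 0 : 'cV_(1 + n)) ->
  F = block_mx x%:M 0 0 (drsubmx F).
Proof.
rewrite -!colE => /colP Fc /colP Fr.
rewrite -{1}[F]submxK; congr block_mx; apply/matrixP => i j; rewrite ?ord1 !mxE.
- have := Fc (lshift m 0); rewrite !mxE /= !mulr1 => <-; congr (F _ _); exact: val_inj.
- have := Fr (rshift 1 j); rewrite !mxE /= !mulr0 => <-; congr (F _ _); exact: val_inj.
- have := Fc (rshift 1 i); rewrite !mxE /= !mulr0 => <-; congr (F _ _); exact: val_inj.
Qed.

Lemma orthogonal_sum_diff_conj m n (F G : 'M[R]_(m, n)) (H : 'M_m) (K : 'M_n) :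
  H^T *m H = 1%:M -> K *m K^T = 1%:M -> orthogonal_sum_diff F G ->
  orthogonal_sum_diff (H *m F *m K) (H *m G *m K).
Proof.
move=> HH KK [FG1 FG2]; rewrite /orthogonal_sum_diff -mulmxBl -mulmxBr -mulmxDl -mulmxDr.
rewrite !trmx_mul; split.
  rewrite -!mulmxA (mulmxA H^T) HH mul1mx (mulmxA (_ - _)^T) FG1.
  by rewrite mul0mx mulmx0.
rewrite -!mulmxA (mulmxA K) KK mul1mx (mulmxA (F - G)) FG2.
by rewrite mul0mx mulmx0.
Qed.

Lemma orthogonal_sum_diff_dr m n x y (F G : 'M[R]_(m, n)) :
  orthogonal_sum_diff (block_mx x 0 0 F : 'M_(1 + m, 1 + n)) (block_mx y 0 0 G) ->
  orthogonal_sum_diff F G.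
Proof.
rewrite /orthogonal_sum_diff opp_block_mx !add_block_mx !tr_block_mx !mulmx_block.
rewrite !oppr0 !addr0 !trmx0 !mul0mx !mulmx0 !addr0 !add0r.
have dr0 k l : drsubmx (0 : 'M[R]_(1 + k, 1 + l)) = 0 by apply/matrixP => i j; rewrite !mxE.
by move=> [/(congr1 drsubmx) + /(congr1 drsubmx)]; rewrite !block_mxKdr !dr0.
Qed.

(** Deflation: reflections taking the first basis vectors to [u] and [v] bring [F] and [G] to block
    diagonal form with corners [x] and [t * x], and the remaining blocks are again an orthogonal
    pair. Decomposability of that smaller pair is a hypothesis, so that the lemma serves both the
    inductive step and the prescription of a singular vector. *)
Lemma signed_svd_cons m n (F G : 'M[R]_(1 + m, 1 + n)) u v (x t : R) :
  dot u u = 1 -> dot v v = 1 -> 0 < x -> t = 1 \/ t = -1 ->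
  F *m v = x *: u -> F^T *m u = x *: v ->
  G *m v = (t * x) *: u -> G^T *m u = (t * x) *: v ->
  orthogonal_sum_diff F G ->
  (forall F' G' : 'M_(m, n), orthogonal_sum_diff F' G' ->
     exists U V Sg S, signed_svd F' G' U V Sg S) ->
  exists U V Sg S, [/\ signed_svd F G U V Sg S, S 0 0 = t, Sg 0 0 = x & col 0 V = v].
Proof.
move=> u1 v1 x0 t1 Fv Fu Gv Gu FG svd.
have e1 k : dot (delta_mx 0 0 : 'cV[R]_k.+1) (delta_mx 0 0) = 1.
  by rewrite /dot trmx_delta mul_delta_mx mxE.
pose H := reflection (delta_mx 0 0 - u); pose K := reflection (delta_mx 0 0 - v).
have He : H *m delta_mx 0 0 = u by apply: reflection_swap.
have Ke : K *m delta_mx 0 0 = v by apply: reflection_swap.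
have HH : H *m H = 1%:M by apply: reflection_invol.
have KK : K *m K = 1%:M by apply: reflection_invol.
have HT : H^T = H by apply: reflection_tr.
have KT : K^T = K by apply: reflection_tr.
have Hu : H *m u = delta_mx 0 0 by rewrite -He mulmxA HH mul1mx.
have Kv : K *m v = delta_mx 0 0 by rewrite -Ke mulmxA KK mul1mx.
have blockE (P : 'M[R]_(1 + m, 1 + n)) y : P *m v = y *: u -> P^T *m u = y *: v ->
    H *m P *m K = block_mx (y%:M : 'M_1) 0 0 (drsubmx (H *m P *m K : 'M_(1 + m, 1 + n))).
  move=> Pv Pu; apply: (@block_mx_singular m n).
    by rewrite -!mulmxA Ke Pv -scalemxAr Hu.
  by rewrite !trmx_mul HT KT -!mulmxA He Pu -scalemxAr Kv.
have := @orthogonal_sum_diff_conj _ _ F G H K; rewrite HT KT => /(_ HH KK FG).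
have FE := blockE _ _ Fv Fu; have GE := blockE _ _ Gv Gu.
rewrite {1}FE {1}GE => /orthogonal_sum_diff_dr /svd [U [V [Sg [S]]]].
move=> [[UU VV] [Sg0 Sgge] F'E [S0 S1 Sg1] G'E].
pose U1 : 'M_(1 + m) := block_mx 1%:M 0 0 U; pose V1 : 'M_(1 + n) := block_mx 1%:M 0 0 V.
exists (H *m U1), (K *m V1), (block_mx (x%:M : 'M_1) 0 0 Sg), (block_mx (t%:M : 'M_1) 0 0 S).
(* [H] and [K] are involutions, so conjugating twice returns to the original matrix. *)
have unblock (P : 'M[R]_(1 + m, 1 + n)) : P = H *m (H *m P *m K) *m K.
  by rewrite !mulmxA HH mul1mx -mulmxA KK mulmx1.
have UU1 : U1 *m U1^T = 1%:M.
  rewrite tr_block_mx mulmx_block !trmx0 !mulmx0 !mul0mx !addr0 !add0r UU.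
  by rewrite trmx1 mulmx1 -scalar_mx_block.
have VV1 : V1 *m V1^T = 1%:M.
  rewrite tr_block_mx mulmx_block !trmx0 !mulmx0 !mul0mx !addr0 !add0r VV.
  by rewrite trmx1 mulmx1 -scalar_mx_block.
split; first split.
- split; rewrite /orthogonalmx trmx_mul ?HT ?KT -mulmxA.
    by rewrite (mulmxA U1) UU1 mul1mx.
  by rewrite (mulmxA V1) VV1 mul1mx.
- split=> i j.
    case: (split_ordP i) => i' ->; case: (split_ordP j) => j' -> ij;
      rewrite ?block_mxEul ?block_mxEur ?block_mxEdl ?block_mxEdr ?mxE //.
      by case: ij; rewrite !ord1.
    by apply: Sg0 => ij'; apply: ij; rewrite /= ij'.
  case: (split_ordP i) => i' ->; case: (split_ordP j) => j' ->;
    rewrite ?block_mxEul ?block_mxEur ?block_mxEdl ?block_mxEdr ?mxE //.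
  by rewrite !ord1 /= ltW.
- have -> : F = H *m (U1 *m block_mx (x%:M : 'M_1) 0 0 Sg *m V1^T) *m K.
    rewrite [LHS]unblock FE F'E /U1 /V1 tr_block_mx !mulmx_block.
    by rewrite !(trmx0, mulmx0, mul0mx, addr0, add0r, trmx1, mulmx1, mul1mx).
  by rewrite trmx_mul KT !mulmxA.
- split.
  + move=> i j; case: (split_ordP i) => i' ->; case: (split_ordP j) => j' -> ij;
      rewrite ?block_mxEul ?block_mxEur ?block_mxEdl ?block_mxEdr ?mxE //.
      by case: ij; rewrite !ord1.
    by apply: S0 => ij'; apply: ij; rewrite /= ij'.
  + move=> i; case: (split_ordP i) => i' ->; rewrite ?block_mxEul ?block_mxEdr //.
    by rewrite !ord1 mxE.
  + move=> i; case: (split_ordP i) => i' ->; rewrite ?block_mxEul ?block_mxEdr.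
      by move=> _; exists (lshift n 0); rewrite !ord1 block_mxEul mxE.
    move=> /Sg1 [j [ji j0]]; exists (rshift 1 j); rewrite block_mxEdr; split=> //.
    by rewrite /= ji.
- have -> : G = H *m (U1 *m block_mx (t%:M : 'M_1) 0 0 S
                        *m block_mx (x%:M : 'M_1) 0 0 Sg *m V1^T) *m K.
    rewrite [LHS]unblock GE G'E /U1 /V1 tr_block_mx !mulmx_block.
    by rewrite !(trmx0, mulmx0, mul0mx, addr0, add0r, trmx1, mulmx1, mul1mx) -scalar_mxM.
  by rewrite trmx_mul KT !mulmxA.
- have -> : 0 = lshift m (0 : 'I_1) :> 'I_(1 + m) by apply: val_inj.
  by rewrite block_mxEul mxE.
- have -> : 0 = lshift m (0 : 'I_1) :> 'I_(1 + m) by apply: val_inj.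
  have -> : 0 = lshift n (0 : 'I_1) :> 'I_(1 + n) by apply: val_inj.
  by rewrite block_mxEul mxE.
- have eE : (delta_mx 0 0 : 'cV[R]_(1 + n)) = col_mx (1%:M : 'M_1) 0.
    apply/matrixP => i j; case: (split_ordP i) => i' ->.
      by rewrite col_mxEu !ord1 !mxE.
    by rewrite col_mxEd !ord1 !mxE.
  rewrite colE -mulmxA -[RHS]Ke; congr (K *m _); rewrite eE.
  by rewrite (@mul_block_col _ 1 n 1 n 1) !(mul0mx, mulmx0, mulmx1, addr0).
Qed.

(** A nonzero eigenvalue [y] of [P^T *m P] with eigenvector [v] is positive because [y * dot v v] is
    the squared length of [P *m v]. Then [Num.sqrt y] is the singular value, and [P *m v], once
    normalized, the left vector. *)
Lemma exists_singular_triple m n (P : 'M[R]_(m, n)) : P != 0 ->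
  exists x u v, [/\ 0 < x, dot u u = 1, dot v v = 1, P *m v = x *: u & P^T *m u = x *: v].
Proof.
move=> P0; have [||y [v [y0 v0 Nv]]] := @symmetric_eigenvector_neq0 n (P^T *m P).
- by rewrite trmx_mul trmxK.
- by apply: contra P0 => /eqP/trmx_mul_eq0 ->.
have PP : dot (P *m v) (P *m v) = y * dot v v by rewrite dot_mulmx dotC mulmxA Nv dotZr.
have vgt : 0 < dot v v by rewrite dot_gt0.
have ygt : 0 < y by rewrite lt0r y0 -(pmulr_lge0 _ vgt) -PP dot_ge0.
pose x := Num.sqrt y; pose z := Num.sqrt (dot v v).
have xgt : 0 < x by rewrite sqrtr_gt0.
have zgt : 0 < z by rewrite sqrtr_gt0.
have xx : x ^+ 2 = y by rewrite sqr_sqrtr // ltW.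
have zz : z ^+ 2 = dot v v by rewrite sqr_sqrtr // ltW.
exists x, ((x * z)^-1 *: (P *m v)), (z^-1 *: v); split=> //.
- by rewrite dotZl dotZr PP -zz -xx; field; rewrite !gt_eqF.
- by rewrite dotZl dotZr -zz; field; rewrite gt_eqF.
- by rewrite -scalemxAr scalerA; congr (_ *: _); field; rewrite !gt_eqF.
- rewrite -scalemxAr mulmxA Nv !scalerA; congr (_ *: _); rewrite -xx.
  by field; rewrite !gt_eqF.
Qed.

(** Deflation for dimensions not written as successors. The position is existential because ['I_m]
    has no canonical element for a general [m]. *)
Lemma signed_svd_prescribed m n (F G : 'M[R]_(m, n)) u v (x t : R) :
  dot u u = 1 -> dot v v = 1 -> 0 < x -> t = 1 \/ t = -1 ->
  F *m v = x *: u -> F^T *m u = x *: v ->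
  G *m v = (t * x) *: u -> G^T *m u = (t * x) *: v ->
  orthogonal_sum_diff F G ->
  (forall F' G' : 'M_(m.-1, n.-1), orthogonal_sum_diff F' G' ->
     exists U V Sg S, signed_svd F' G' U V Sg S) ->
  exists U V Sg S (i : 'I_m) (j : 'I_n),
    [/\ signed_svd F G U V Sg S, (i : nat) = j, S i i = t, Sg i j = x & col j V = v].
Proof.
(* In dimension 0 the inner product is an empty sum, so there is no unit vector. *)
case: m => [|m] in F G u *; first by rewrite dotE big_ord0 => /esym/eqP; rewrite oner_eq0.
case: n => [|n] in F G v *.
  by move=> _; rewrite dotE big_ord0 => /esym/eqP; rewrite oner_eq0.
move=> u1 v1 x0 t1 Fv Fu Gv Gu FG svd.
have [U [V [Sg [S [? ? ? ?]]]]] := @signed_svd_cons m n F G u v x t u1 v1 x0 t1 Fv Fu Gv Gu FG svd.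
by exists U, V, Sg, S, 0, 0; split.
Qed.

Lemma half_addE m n (F G : 'M[R]_(m, n)) : F = 2^-1 *: ((F + G) + (F - G)).
Proof. by apply/matrixP => i j; rewrite !mxE; field. Qed.

Lemma half_subE m n (F G : 'M[R]_(m, n)) : G = 2^-1 *: ((F + G) - (F - G)).
Proof. by apply/matrixP => i j; rewrite !mxE; field. Qed.

Lemma orthogonal_sum_diff_sym m n (F G : 'M[R]_(m, n)) : orthogonal_sum_diff F G ->
  (F + G)^T *m (F - G) = 0 /\ (F + G) *m (F - G)^T = 0.
Proof.
by move=> [FG1 FG2]; split; apply: trmx_inj; rewrite trmx_mul trmxK ?FG1 ?FG2 trmx0.
Qed.

Lemma signed_svd0 m n : signed_svd (0 : 'M[R]_(m, n)) 0 1%:M 1%:M 0 1%:M.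
Proof.
split; rewrite ?mulmx0 ?mul0mx //.
- by split; rewrite /orthogonalmx trmx1 mulmx1.
- by split=> i j; rewrite mxE.
- split=> [i j /eqP ij|i|i]; rewrite mxE ?eqxx ?(negPf ij) //; first by left.
  by move=> /eqP; rewrite -subr_eq0 opprK (pnatr_eq0 _ 2).
Qed.

(** Induction on the number of rows. As long as [F - G] is nonzero, one of its singular triples is
    split off with sign -1; once [F = G], a triple of [F + G] is split off with sign 1. *)
Lemma signed_svd_exists m n (F G : 'M[R]_(m, n)) : orthogonal_sum_diff F G ->
  exists U V Sg S, signed_svd F G U V Sg S.
Proof.
elim: m => [|m IH] in n F G *.
  move=> _; exists 1%:M, 1%:M, 0, 1%:M.
  by rewrite [F]flatmx0 [G]flatmx0; apply: signed_svd0.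
move=> FG; have [GF1 GF2] := orthogonal_sum_diff_sym FG.
have FE := half_addE F G; have GE := half_subE F G.
have [FmG|FmG] := eqVneq (F - G) 0; last first.
  have [x [u [v [x0 u1 v1 Pv Pu]]]] := exists_singular_triple FmG.
  have x0' : x != 0 by rewrite gt_eqF.
  (* The vector [v] lies in the row space of [F - G], which [F + G] annihilates; likewise [u] and
     the column space below. *)
  have Qv : (F + G) *m v = 0.
    by apply: (scalerI x0'); rewrite scalemxAr -Pu mulmxA GF2 mul0mx scaler0.
  have Qu : (F + G)^T *m u = 0.
    by apply: (scalerI x0'); rewrite scalemxAr -Pv mulmxA GF1 mul0mx scaler0.
  (* On [v] and [u] only the half differences act, so [F] has singular value [x / 2] there and [G]
     its opposite. *)
  have [] := @signed_svd_prescribed m.+1 n F G u v (x / 2) (-1) u1 v1 _ _ _ _ _ _ FG (IH _).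
  - by rewrite divr_gt0.
  - by right.
  - by rewrite FE -scalemxAl mulmxDl Qv Pv add0r scalerA mulrC.
  - by rewrite FE linearZ linearD /= -scalemxAl mulmxDl Qu Pu add0r scalerA mulrC.
  - by rewrite GE -scalemxAl mulmxBl Qv Pv sub0r scalerN scalerA mulN1r scaleNr mulrC.
  - rewrite GE linearZ linearB /= -scalemxAl mulmxBl Qu Pu sub0r scalerN scalerA.
    by rewrite mulN1r scaleNr mulrC.
  by move=> U [V [Sg [S [i [j [? _ _ _ _]]]]]]; exists U, V, Sg, S.
have [FpG|FpG] := eqVneq (F + G) 0.
  have -> : F = 0 by rewrite FE FpG FmG addr0 scaler0.
  have -> : G = 0 by rewrite GE FpG FmG subr0 scaler0.
  by exists 1%:M, 1%:M, 0, 1%:M; apply: signed_svd0.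
have [x [u [v [x0 u1 v1 Pv Pu]]]] := exists_singular_triple FpG.
have [] := @signed_svd_prescribed m.+1 n F G u v (x / 2) 1 u1 v1 _ _ _ _ _ _ FG (IH _).
- by rewrite divr_gt0.
- by left.
- by rewrite FE FmG addr0 -scalemxAl Pv scalerA mulrC.
- by rewrite FE FmG addr0 linearZ /= -scalemxAl Pu scalerA mulrC.
- by rewrite GE FmG subr0 -scalemxAl Pv scalerA mulrC mul1r.
- by rewrite GE FmG subr0 linearZ /= -scalemxAl Pu scalerA mulrC mul1r.
by move=> U [V [Sg [S [i [j [? _ _ _ _]]]]]]; exists U, V, Sg, S.
Qed.

(** * Convertibility as orthogonality of sum and difference *)

Lemma conv_data_signed_svd m n (F G : 'M[R]_(m, n)) U V Sg S i :
  signed_svd F G U V Sg S -> S i i = -1 -> conv_data F G U V Sg S.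
Proof. by move=> [? ? ? [? ? ?] ?] Si; split=> //; split=> //; exists i. Qed.

Lemma mulmx_diagl m n (S : 'M[R]_m) (D : 'M[R]_(m, n)) i j :
  (forall i j, i <> j -> S i j = 0) -> (S *m D) i j = S i i * D i j.
Proof.
move=> S0; rewrite mxE (bigD1 i) //= big1 ?addr0 // => k ki.
by rewrite S0 ?mul0r // => ik; move: ki; rewrite ik eqxx.
Qed.

Lemma diagonalmx_tr m (S : 'M[R]_m) : (forall i j, i <> j -> S i j = 0) -> S^T = S.
Proof.
move=> S0; apply/matrixP => i j; rewrite mxE; have [-> //|/eqP ij] := eqVneq i j.
by rewrite !S0 // => ji; apply: ij.
Qed.

(** Orthogonal invariance reduces the claim to the pair [Sg], [S *m Sg]. One product vanishes
    because [S] squares to the identity, the other because [S] moreover commutes with the diagonal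
    matrix [Sg *m Sg^T]. *)
Lemma conv_data_orthogonal m n (F G : 'M[R]_(m, n)) U V Sg S :
  conv_data F G U V Sg S -> orthogonal_sum_diff F G.
Proof.
move=> [[UU VV] [Sg0 _] -> [S0 S1 _ _] ->].
have ST := diagonalmx_tr S0.
have SS : S *m S = 1%:M.
  apply/matrixP => i j; rewrite mulmx_diagl // mxE; have [<-|/eqP ij] := eqVneq i j.
    by case: (S1 i) => ->; rewrite ?mulrNN mulr1.
  by rewrite (S0 i j) ?mulr0.
have UU' : U^T *m U = 1%:M by apply: mulmx1C.
have VV' : V^T *m V = 1%:M by apply: mulmx1C.
have Sd : orthogonal_sum_diff Sg (S *m Sg).
  split; rewrite ?linearB ?linearD /= ?trmx_mul ST !mulmxBl !mulmxA.
    by rewrite -(mulmxA _ S S) SS mulmx1 addrA subrK subrr.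
  (* Each column of [Sg] has at most one nonzero entry. *)
  have Sg2_0 i j : i <> j -> (Sg *m Sg^T) i j = 0.
    move=> ij; rewrite mxE big1 // => k _; rewrite mxE.
    have [ik|/eqP ik] := eqVneq (i : nat) k; last by rewrite (Sg0 i k ik) mul0r.
    by rewrite (Sg0 j) ?mulr0 // -ik => ji; apply: ij; apply/esym/val_inj.
  have SgS : S *m Sg *m Sg^T = Sg *m Sg^T *m S.
    rewrite -mulmxA -[RHS]trmxK trmx_mul ST (diagonalmx_tr Sg2_0).
    apply/matrixP => i j; rewrite mulmx_diagl // [RHS]mxE mulmx_diagl //.
    have [-> //|/eqP ij] := eqVneq i j.
    by rewrite !Sg2_0 ?mulr0 // => ji; apply: ij.
  rewrite SgS -(mulmxA _ S S) SS mulmx1.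
  by rewrite addrA subrK subrr.
rewrite -(mulmxA U S Sg).
by apply: orthogonal_sum_diff_conj => //; rewrite trmxK.
Qed.

Lemma convertible_orthogonal m n (F G : 'M[R]_(m, n)) : F != G ->
  convertible F G <-> orthogonal_sum_diff F G.
Proof.
move=> FnG; split=> [[U [V [Sg [S]]]] /conv_data_orthogonal //|].
move=> /signed_svd_exists [U [V [Sg [S svd]]]].
have [i /eqP Si|S1] := pickP (fun i => S i i == -1).
  by exists U, V, Sg, S; apply: (conv_data_signed_svd svd Si).
(* Without an entry -1 the matrix [S] is the identity, and then [F = G]. *)
case/eqP: FnG; case: svd => _ _ -> [S0 S1' _] ->; congr (_ *m _ *m _).
rewrite -[LHS]mulmx1; congr (_ *m _); apply/matrixP => i j; rewrite mxE.
have [<-|/eqP/S0 //] := eqVneq i j.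
by case: (S1' i) => // Si; have := S1 i; rewrite Si eqxx.
Qed.

(** * Gram singular values and vectors read off from the difference *)

Lemma conv_data_sub m n (F G : 'M[R]_(m, n)) U V Sg S :
  conv_data F G U V Sg S -> G - F = U *m ((S - 1%:M) *m Sg) *m V^T.
Proof.
by move=> [_ _ -> _ ->]; rewrite (mulmxBl S) mul1mx mulmxBr mulmxBl !mulmxA.
Qed.

Lemma conv_data_sub_entry m n (F G : 'M[R]_(m, n)) U V Sg S i j :
  conv_data F G U V Sg S -> ((S - 1%:M) *m Sg) i j = (S i i - 1) * Sg i j.
Proof.
move=> [_ _ _ [S0 _ _ _] _]; rewrite mulmx_diagl ?mxE ?eqxx // => i' j' ij.
by rewrite !mxE S0 // (introF eqP ij) subr0.
Qed.

(** In the bases [U] and [V] the difference [G - F] is rectangular diagonal, with entry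
    [- 2 * Sg i j] at a sign -1 and 0 at a sign 1, so matching columns of [U] and [V] are mapped to
    multiples of each other. *)
Lemma conv_data_triple m n (F G : 'M[R]_(m, n)) U V Sg S (i : 'I_m) (j : 'I_n) :
  conv_data F G U V Sg S -> (i : nat) = j -> S i i = -1 ->
  [/\ 0 < Sg i j, col j V != 0,
      (G - F) *m col j V = (- 2 * Sg i j) *: col i U &
      (G - F)^T *m col i U = (- 2 * Sg i j) *: col j V].
Proof.
move=> FG ij Si; have FGE := conv_data_sub FG.
have [[UU VV] [Sg0 _] _ [_ _ _ Sgt] _] := FG.
have UU' : U^T *m U = 1%:M by apply: mulmx1C.
have VV' : V^T *m V = 1%:M by apply: mulmx1C.
have TE := fun i j => conv_data_sub_entry i j FG; move: FGE TE.
move: ((S - 1%:M) *m Sg) => T FGE TE.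
have Tij : T i j = - 2 * Sg i j by rewrite TE Si; ring.
split.
- have [j' [j'i]] := Sgt i Si.
  by have -> : j' = j by apply: val_inj; rewrite /= j'i.
- apply/eqP => Vj; have : V^T *m col j V = 0 by rewrite Vj mulmx0.
  rewrite colE mulmxA VV' mul1mx => /colP/(_ j); rewrite !mxE !eqxx => /eqP.
  by rewrite oner_eq0.
- rewrite FGE !colE -!mulmxA (mulmxA V^T) VV' mul1mx scalemxAr -!colE.
  congr (_ *m _); apply/colP => i'; rewrite !mxE andbT; have [->|/eqP ii'] := eqVneq i' i.
    by rewrite mulr1 Tij.
  by rewrite mulr0 TE Sg0 ?mulr0 // -ij => i'i; apply: ii'; apply: val_inj.
- rewrite FGE !trmx_mul trmxK !colE -!mulmxA (mulmxA U^T) UU' mul1mx scalemxAr -!colE.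
  congr (_ *m _); apply/colP => j'; rewrite !mxE andbT; have [->|/eqP jj'] := eqVneq j' j.
    by rewrite mulr1 Tij.
  by rewrite mulr0 TE Sg0 ?mulr0 // ij => j'j; apply: jj'; apply: val_inj.
Qed.

(** Expand [w] in the columns of [V]. A nonzero coordinate [j] forces the squared diagonal entry of
    [G - F] there to be [4 * lam]; this entry is nonzero, so the sign is -1 and the entry equals
    [- 2 * Sg i j]. *)
Lemma conv_data_eigen m n (F G : 'M[R]_(m, n)) U V Sg S (lam : R) (w : 'cV_n) :
  conv_data F G U V Sg S -> 0 < lam -> w != 0 ->
  (G - F)^T *m ((G - F) *m w) = (4 * lam) *: w ->
  exists (i : 'I_m) (j : 'I_n), [/\ (i : nat) = j, S i i = -1 & Sg i j = Num.sqrt lam].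
Proof.
move=> FG lam0 w0; have FGE := conv_data_sub FG.
have [[UU VV] [Sg0 Sgge] _ [_ S1 _ _] _] := FG.
have UU' : U^T *m U = 1%:M by apply: mulmx1C.
have VV' : V^T *m V = 1%:M by apply: mulmx1C.
have TE := fun i j => conv_data_sub_entry i j FG; move: FGE TE.
move: ((S - 1%:M) *m Sg) => T FGE TE.
have [y wE] : exists y, w = V *m y by exists (V^T *m w); rewrite mulmxA VV mul1mx.
rewrite FGE wE !trmx_mul trmxK -!mulmxA (mulmxA V^T V) VV' mul1mx (mulmxA U^T U) UU' mul1mx.
rewrite scalemxAr => /(congr1 (mulmx V^T)); rewrite !(mulmxA V^T V) VV' !mul1mx => Ty.
have T0 (i : 'I_m) (j : 'I_n) : (i : nat) <> j -> T i j = 0 by move=> ij; rewrite TE Sg0 ?mulr0.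
have [j yj] : exists j, y j 0 != 0.
  apply/existsP; apply: contraNT w0 => /existsPn y0; rewrite wE.
  have -> : y = 0 by apply/colP => j; rewrite mxE; apply/eqP; have := y0 j; rewrite negbK.
  by rewrite mulmx0.
have lhs0 : (T^T *m (T *m y)) j 0 != 0.
  by rewrite Ty mxE mulf_neq0 // mulf_neq0 // ?pnatr_eq0 // gt_eqF.
(* If no row matched the column [j], that column of [T] would vanish, against [lhs0]. *)
have [i ij] : exists i : 'I_m, (i : nat) = j.
  have [i /eqP ij|nij] := pickP (fun i : 'I_m => (i : nat) == j); first by exists i.
  case/eqP: lhs0; rewrite mxE big1 // => i _; rewrite mxE T0 ?mul0r //.
  by apply/eqP; rewrite nij.
have TyE : (T^T *m (T *m y)) j 0 = T i j ^+ 2 * y j 0.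
  rewrite mxE (bigD1 i) //= big1 => [|i' i'i]; last first.
    rewrite mxE T0 ?mul0r // -ij => /val_inj i'E; by rewrite i'E eqxx in i'i.
  rewrite !mxE (bigD1 j) //= big1 => [|j' j'j]; last first.
    rewrite T0 ?mul0r // ij => /val_inj j'E; by rewrite j'E eqxx in j'j.
  by rewrite !addr0 mulrA expr2.
have T2 : T i j ^+ 2 = 4 * lam.
  by apply: (mulIf yj); rewrite -TyE Ty mxE.
have Tij0 : T i j != 0.
  by rewrite -sqrf_eq0 T2 mulf_neq0 // ?pnatr_eq0 // gt_eqF.
exists i, j; split=> //.
  by case: (S1 i) => // Si; move: Tij0; rewrite TE Si subrr mul0r eqxx.
have Si : S i i = -1.
  by case: (S1 i) => // Si; move: Tij0; rewrite TE Si subrr mul0r eqxx.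
have <- : Sg i j ^+ 2 = lam by move: T2; rewrite TE Si => ?; lra.
by rewrite sqrtr_sqr ger0_norm.
Qed.

(** The given [v] extends to a singular triple of [G - F], and [F + G] annihilates both of its
    vectors, so deflation can start from this triple with sign -1. *)
Lemma conv_data_prescribed m n (F G : 'M[R]_(m, n)) (lam : R) (v : 'cV_n) :
  orthogonal_sum_diff F G -> 0 < lam -> dot v v = 1 ->
  (G - F)^T *m ((G - F) *m v) = (4 * lam) *: v ->
  exists U V Sg S (i : 'I_m) (j : 'I_n),
    [/\ conv_data F G U V Sg S, (i : nat) = j, S i i = -1, Sg i j = Num.sqrt lam & col j V = v].
Proof.
move=> FG lam0 v1 Ev; pose x := Num.sqrt lam.
have x0 : 0 < x by rewrite sqrtr_gt0.
have x2 : x ^+ 2 = lam by rewrite sqr_sqrtr // ltW.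
have x0' : x != 0 by rewrite gt_eqF.
(* The minus sign makes [u] the left vector of [F]: as [F + G] annihilates [v], [F *m v] is minus
   half of [E *m v]. *)
pose E := G - F; pose u := - (2 * x)^-1 *: (E *m v).
have [GF1 GF2] := orthogonal_sum_diff_sym FG.
have FmG : F - G = - E by rewrite opprB.
have Qv : (F + G) *m v = 0.
  apply: (@scalerI _ _ (4 * lam)); first by rewrite mulf_neq0 ?pnatr_eq0 // gt_eqF.
  rewrite scalemxAr -Ev -/E (mulmxA (F + G)); move: GF2.
  by rewrite FmG linearN /= mulmxN => /eqP; rewrite oppr_eq0 => /eqP ->; rewrite mul0mx scaler0.
have Qu : (F + G)^T *m u = 0.
  rewrite /u -scalemxAr mulmxA; move: GF1.
  by rewrite FmG mulmxN => /eqP; rewrite oppr_eq0 => /eqP ->; rewrite mul0mx scaler0.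
have Eu : E^T *m u = (- 2 * x) *: v.
  rewrite /u -scalemxAr Ev scalerA; congr (_ *: _); rewrite -x2; by field.
have Ev' : E *m v = (- 2 * x) *: u.
  rewrite /u scalerA -[LHS]scale1r; congr (_ *: _); by field.
clearbody u.
(* Evaluating [dot u (E *m v)] in two ways gives [u] and [v] the same length. *)
have u1 : dot u u = 1.
  have : dot u (E *m v) = dot (E^T *m u) v by rewrite dot_mulmx.
  rewrite Ev' Eu dotZr dotZl v1 => /mulfI -> //.
  by rewrite mulf_neq0 // oppr_eq0 pnatr_eq0.
have FE := half_addE F G; have GE := half_subE F G; rewrite FmG in FE GE.
have [] := @signed_svd_prescribed m n F G u v x (-1) u1 v1 x0 _ _ _ _ _ FG.
- by right.
- by rewrite FE -scalemxAl mulmxBl Qv Ev' sub0r -scaleNr scalerA; congr (_ *: _); field.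
- rewrite FE linearZ linearB /= -scalemxAl mulmxBl Qu Eu sub0r -scaleNr scalerA.
  by congr (_ *: _); field.
- by rewrite GE opprK -scalemxAl mulmxDl Qv Ev' add0r scalerA; congr (_ *: _); field.
- rewrite GE opprK linearZ linearD /= -scalemxAl mulmxDl Qu Eu add0r scalerA.
  by congr (_ *: _); field.
- by move=> F' G' /signed_svd_exists.
move=> U [V [Sg [S [i [j [svd ij Si Sgi Vj]]]]]].
by exists U, V, Sg, S, i, j; split=> //; apply: (conv_data_signed_svd svd Si).
Qed.

Lemma normalize_dot n (w : 'cV[R]_n) : normalize w = (Num.sqrt (dot w w))^-1 *: w.
Proof.
by rewrite /normalize dotE; congr ((Num.sqrt _)^-1 *: _); apply: eq_bigr => i _; rewrite expr2.
Qed.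

Lemma dot_normalize n (w : 'cV[R]_n) : w != 0 -> dot (normalize w) (normalize w) = 1.
Proof.
rewrite -dot_gt0 => w0; rewrite normalize_dot dotZl dotZr.
rewrite -{3}[dot w w]sqr_sqrtr ?ltW //; field.
by rewrite gt_eqF // sqrtr_gt0.
Qed.

(** * Singular values of a product [Y *m X^T] through a small matrix *)

Section FactoredMatrix.
Variables (m n k : nat) (Y : 'M[R]_(m, k)) (X : 'M[R]_(n, k)).
Let M := 4^-1 *: (Y^T *m Y *m (X^T *m X)).

(** The second equation puts [v] in the range of [X], with coordinate vector [mu^-1 *: (Y^T *m u)];
    this vector is the eigenvector of [M]. *)
Lemma eigenval_of_triple (u : 'cV_m) (v : 'cV_n) (mu : R) : mu != 0 -> v != 0 ->
  Y *m X^T *m v = mu *: u -> (Y *m X^T)^T *m u = mu *: v -> eigenval M (mu ^+ 2 / 4).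
Proof.
move=> mu0 v0 Ev; rewrite trmx_mul trmxK -mulmxA => Eu.
have vE : v = X *m (mu^-1 *: (Y^T *m u)).
  by rewrite -scalemxAr Eu scalerA mulVf // scale1r.
exists (mu^-1 *: (Y^T *m u)); split.
  by apply: contra v0 => /eqP z0; rewrite vE z0 mulmx0.
rewrite /M -scalemxAl -!mulmxA -vE (mulmxA Y) Ev -scalemxAr !scalerA.
by congr (_ *: _); field.
Qed.

Hypotheses (Xinj : forall z : 'cV_k, X *m z = 0 -> z = 0)
  (Yinj : forall z : 'cV_k, Y *m z = 0 -> z = 0).

(** With [E = Y *m X^T], the matrix [E^T *m E] maps [X *m z] to [4 *: (X *m (M *m z))]. Positivity
    of [lam] comes from comparing the squared lengths of [E *m (X *m z)] and [X *m z], both nonzero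
    by injectivity of [Y] and [X]. *)
Lemma eigenpair_factored (lam : R) (z : 'cV_k) : eigenpair M lam z ->
  [/\ 0 < lam, X *m z != 0 &
      (Y *m X^T)^T *m (Y *m X^T *m (X *m z)) = (4 * lam) *: (X *m z)].
Proof.
move=> [z0 Mz]; have Xz : X *m z != 0 by apply: contra z0 => /eqP/Xinj ->.
have EE : (Y *m X^T)^T *m (Y *m X^T *m (X *m z)) = (4 * lam) *: (X *m z).
  rewrite trmx_mul trmxK -scalerA scalemxAr -Mz /M -scalemxAl -scalemxAr scalerA.
  by rewrite mulfV ?pnatr_eq0 // scale1r !mulmxA.
split=> //.
have Ew : Y *m X^T *m (X *m z) != 0.
  apply: contra Xz => /eqP; rewrite -mulmxA => /Yinj XXz.
  by rewrite -dot_eq0 dot_mulmx XXz /dot trmx0 mul0mx mxE.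
have := dot_gt0 (Y *m X^T *m (X *m z)); rewrite Ew dot_mulmx dotC EE dotZr.
by rewrite pmulr_lgt0 ?dot_gt0 // pmulr_rgt0.
Qed.

End FactoredMatrix.

End SimultaneousSVD.

(** * Skew-symmetric matrices of rank at most two *)

Section RankTwo.
Variable R : realType.

Definition pair_mx n (x1 x2 : 'cV[R]_n) : 'M[R]_(n, 2) :=
  \matrix_(i, j) (if (j : nat) == 0%N then x1 else x2) i 0.

Lemma mul_pair_mxT m n (y1 y2 : 'cV[R]_m) (x1 x2 : 'cV[R]_n) :
  pair_mx y1 y2 *m (pair_mx x1 x2)^T = y1 *m x1^T + y2 *m x2^T.
Proof.
by apply/matrixP => i j; rewrite !mxE !big_ord_recl !big_ord0 /= !mxE !addr0.
Qed.

Lemma mul_pair_mx n (x1 x2 : 'cV[R]_n) (z : 'cV_2) :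
  pair_mx x1 x2 *m z = z 0 0 *: x1 + z ord_max 0 *: x2.
Proof.
apply/colP => i; rewrite !mxE !big_ord_recl !big_ord0 /= !mxE addr0 !(mulrC (z _ _)).
by congr (_ + _ * z _ _); apply: val_inj.
Qed.

Lemma mul_trmx_pair_mx n (x1 x2 : 'cV[R]_n) i j :
  ((pair_mx x1 x2)^T *m pair_mx x1 x2) i j =
  dot (if (i : nat) == 0%N then x1 else x2) (if (j : nat) == 0%N then x1 else x2).
Proof. by rewrite mxE dotE; apply: eq_bigr => k _; rewrite !mxE. Qed.

(* A certificate of linear independence: one coordinate sees only [y1],
   another one only [y2], each with a sign. *)
Definition separated n (y1 y2 : 'cV[R]_n) : Prop :=
  exists i j, [/\ y1 i 0 ^+ 2 = 1, y2 i 0 = 0, y1 j 0 = 0 & y2 j 0 ^+ 2 = 1].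

Lemma separated_inj n (y1 y2 : 'cV[R]_n) (s t : R) : separated y1 y2 ->
  s *: y1 + t *: y2 = 0 -> s = 0 /\ t = 0.
Proof.
move=> [i [j [y1i y2i y1j y2j]]] /colP st.
move: (st i) (st j); rewrite !mxE y2i y1j !mulr0 addr0 add0r => si tj; split.
  by rewrite -[s]mulr1 -y1i expr2 mulrA si mul0r.
by rewrite -[t]mulr1 -y2j expr2 mulrA tj mul0r.
Qed.

Lemma pair_mx_inj n (y1 y2 : 'cV[R]_n) : separated y1 y2 ->
  forall z : 'cV_2, pair_mx y1 y2 *m z = 0 -> z = 0.
Proof.
move=> y12 z; rewrite mul_pair_mx => /(separated_inj y12) [z0 z1].
apply/colP => i; rewrite [RHS]mxE.
case: i => -[|[|//]] ilt.
  by rewrite -[RHS]z0; congr (z _ _); apply: val_inj.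
by rewrite -[RHS]z1; congr (z _ _); apply: val_inj.
Qed.

(** Reading skewness in column [i], where [y2] vanishes, makes [w1] a multiple of [y2]; column [j]
    makes [w2] a multiple of [y1]. The matrix becomes [t] times the wedge of [y1] and [y2], whose
    entry at [i], [j] is 1 or -1. *)
Lemma skew_rank_two n (y1 y2 w1 w2 : 'cV[R]_n) : separated y1 y2 ->
  w1 *m y1^T + w2 *m y2^T + (w1 *m y1^T + w2 *m y2^T)^T = 0 ->
  exists t, [/\ w1 = - t *: y2, w2 = t *: y1 &
             w1 *m y1^T + w2 *m y2^T = 0 <-> t = 0].
Proof.
move=> y12; have [i [j [y1i y2i y1j y2j]]] := y12 => /matrixP skew.
have {}skew a b : w1 a 0 * y1 b 0 + w2 a 0 * y2 b 0 + (w1 b 0 * y1 a 0 + w2 b 0 * y2 a 0) = 0.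
  by have := skew a b; rewrite !mxE !big_ord1 !mxE.
have w1E a : w1 a 0 = - (y1 i 0 * w2 i 0) * y2 a 0.
  have si := skew i i; have sa := skew a i; rewrite y2i in si sa.
  have w1i : w1 i 0 = 0.
    by rewrite -[w1 i 0]mulr1 -y1i expr2 mulrA (_ : w1 i 0 * y1 i 0 = 0) ?mul0r //; lra.
  rewrite w1i in sa; rewrite -[LHS]mulr1 -y1i expr2 mulrA.
  by rewrite (_ : w1 a 0 * y1 i 0 = - (w2 i 0 * y2 a 0)); [ring | lra].
have w2E a : w2 a 0 = - (y2 j 0 * w1 j 0) * y1 a 0.
  have sj := skew j j; have sa := skew a j; rewrite y1j in sj sa.
  have w2j : w2 j 0 = 0.
    by rewrite -[w2 j 0]mulr1 -y2j expr2 mulrA (_ : w2 j 0 * y2 j 0 = 0) ?mul0r //; lra.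
  rewrite w2j in sa; rewrite -[LHS]mulr1 -y2j expr2 mulrA.
  by rewrite (_ : w2 a 0 * y2 j 0 = - (w1 j 0 * y1 a 0)); [ring | lra].
(* The two multiples are opposite, so a single scalar [t] describes both. *)
have tE : - (y2 j 0 * w1 j 0) = y1 i 0 * w2 i 0.
  by rewrite (w2E i) mulrCA -expr2 y1i mulr1.
exists (y1 i 0 * w2 i 0).
have w1E' : w1 = - (y1 i 0 * w2 i 0) *: y2 by apply/colP => a; rewrite w1E !mxE.
have w2E' : w2 = (y1 i 0 * w2 i 0) *: y1 by apply/colP => a; rewrite w2E tE !mxE.
split=> //; split=> [/matrixP/(_ i j)|t0].
  rewrite !mxE !big_ord1 !mxE y1j mulr0 add0r => w2y2.
  by rewrite -[w2 i 0]mulr1 -y2j expr2 (mulrA (w2 _ _)) w2y2 mul0r mulr0.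
have -> : w1 = 0 by rewrite w1E' t0 oppr0 scale0r.
have -> : w2 = 0 by rewrite w2E' t0 scale0r.
by rewrite !mul0mx addr0.
Qed.

End RankTwo.

(** * The block matrices, their factors and the row conditions *)

Section Blocks.
Variable R : realType.

Definition yvec1 (k l p q r s : nat) :=
  col6 (Jmx R k 1) (- Jmx R l 1) (0 : 'cV[R]_p) (0 : 'cV[R]_q) (Jmx R r 1) (- Jmx R s 1).
Definition yvec2 (k l p q r s : nat) :=
  col6 (0 : 'cV[R]_k) (0 : 'cV[R]_l) (Jmx R p 1) (- Jmx R q 1) (- Jmx R r 1) (Jmx R s 1).

Lemma Jmx_mul p q r : Jmx R p q *m Jmx R q r = q%:R *: Jmx R p r.
Proof.
apply/matrixP => i j; rewrite !mxE mulr1.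
rewrite (eq_bigr (fun _ => 1)) => [|l _]; last by rewrite !mxE mulr1.
by rewrite sumr_const card_ord.
Qed.

Lemma Jmx_mul1 p q : Jmx R p 1 *m Jmx R 1 q = Jmx R p q.
Proof. by rewrite Jmx_mul scale1r. Qed.

Lemma tr_Jmx p q : (Jmx R p q)^T = Jmx R q p.
Proof. exact: trmx_const. Qed.

Lemma tr_NJmx p q : (- Jmx R p q)^T = - Jmx R q p.
Proof. by rewrite linearN /= tr_Jmx. Qed.

Lemma tr_col6 n m1 m2 m3 m4 m5 m6 (B1 : 'M[R]_(m1, n)) (B2 : 'M[R]_(m2, n))
  (B3 : 'M[R]_(m3, n)) (B4 : 'M[R]_(m4, n)) (B5 : 'M[R]_(m5, n)) (B6 : 'M[R]_(m6, n)) :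
  (col6 B1 B2 B3 B4 B5 B6)^T = row6 B1^T B2^T B3^T B4^T B5^T B6^T.
Proof. by rewrite /col6 /row6 !tr_col_mx. Qed.

(** The last two block rows come from the difference of [xvec1] and [xvec2], in which the parts of
    sizes [a] and [b] cancel. *)
Lemma EmatE a b c d e f k l p q r s : Emat R a b c d e f k l p q r s =
  yvec1 k l p q r s *m (xvec1 R a b c d e f)^T + yvec2 k l p q r s *m (xvec2 R a b c d e f)^T.
Proof.
rewrite /xvec1 /xvec2 !tr_col6 !tr_NJmx !trmx0 !tr_Jmx.
rewrite /Emat /yvec1 /yvec2 /col6 /row6 !mul_col_mx !mul_mx_row.
rewrite !(mulNmx, mulmxN, mulmx0, mul0mx, Jmx_mul1, opprK, oppr0).
by rewrite !add_col_mx !add_row_mx !(addr0, add0r, subrr, addNr).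
Qed.

Lemma row_col_mx m1 m2 n1 n2 (B1 : 'M[R]_(m1, n1)) (B2 : 'M[R]_(m2, n1))
  (B3 : 'M[R]_(m1, n2)) (B4 : 'M[R]_(m2, n2)) :
  row_mx (col_mx B1 B2) (col_mx B3 B4) = col_mx (row_mx B1 B3) (row_mx B2 B4).
Proof. by rewrite -block_mxEh block_mxEv. Qed.

Lemma tr_Emat a b c d e f k l p q r s :
  (Emat R a b c d e f k l p q r s)^T = Emat R k l p q r s a b c d e f.
Proof.
rewrite /Emat tr_col6 /row6 /col6 !tr_row_mx !tr_NJmx !trmx0 !tr_Jmx.
by rewrite !row_col_mx.
Qed.

(** Transposition exchanges the [X] and [Z] blocks and fixes the place of the [Y] blocks; hence (i),
    (iii), (v) for the transpose are (vi), (iv), (ii). *)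
Lemma tr_Amat a b c d e f k l p q r s
  (X11 : 'M[R]_(k, e)) (X12 : 'M[R]_(k, f)) (X21 : 'M[R]_(l, e)) (X22 : 'M[R]_(l, f))
  (Y11 : 'M[R]_(p, c)) (Y12 : 'M[R]_(p, d)) (Y21 : 'M[R]_(q, c)) (Y22 : 'M[R]_(q, d))
  (Z11 : 'M[R]_(r, a)) (Z12 : 'M[R]_(r, b)) (Z21 : 'M[R]_(s, a)) (Z22 : 'M[R]_(s, b)) :
  (Amat X11 X12 X21 X22 Y11 Y12 Y21 Y22 Z11 Z12 Z21 Z22)^T =
  Amat Z11^T Z21^T Z12^T Z22^T Y11^T Y21^T Y12^T Y22^T X11^T X21^T X12^T X22^T.
Proof.
rewrite /Amat tr_col6 /row6 /col6 !tr_row_mx !trmx0 !tr_Jmx.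
by rewrite !row_col_mx.
Qed.

Lemma ord_addn_gt0 k l : (0 < k + l)%N -> inhabited 'I_k \/ inhabited 'I_l.
Proof.
rewrite addn_gt0 => /orP [k0|l0]; [left | right].
  exact: (inhabits (Ordinal k0)).
exact: (inhabits (Ordinal l0)).
Qed.

Lemma separated_yvec k l p q r s : (0 < k + l)%N -> (0 < p + q)%N ->
  separated (yvec1 k l p q r s) (yvec2 k l p q r s).
Proof.
move=> kl pq.
have [i [y1i y2i]] : exists i, yvec1 k l p q r s i 0 ^+ 2 = 1 /\ yvec2 k l p q r s i 0 = 0.
  have [[i0]|[i0]] := ord_addn_gt0 kl.
    by exists (lshift _ i0); rewrite /yvec1 /yvec2 /col6 !col_mxEu !mxE expr1n.
  by exists (rshift _ (lshift _ i0));
    rewrite /yvec1 /yvec2 /col6 !(col_mxEu, col_mxEd) !mxE sqrrN expr1n.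
have [j [y1j y2j]] : exists j, yvec1 k l p q r s j 0 = 0 /\ yvec2 k l p q r s j 0 ^+ 2 = 1.
  have [[j0]|[j0]] := ord_addn_gt0 pq.
    by exists (rshift _ (rshift _ (lshift _ j0)));
      rewrite /yvec1 /yvec2 /col6 !(col_mxEu, col_mxEd) !mxE expr1n.
  by exists (rshift _ (rshift _ (rshift _ (lshift _ j0))));
    rewrite /yvec1 /yvec2 /col6 !(col_mxEu, col_mxEd) !mxE sqrrN expr1n.
by exists i, j.
Qed.

(** The witnesses come from the middle and last pairs of blocks, since the two vectors agree on the
    first pair. *)
Lemma separated_xvec a b c d e f : (0 < c + d)%N -> (0 < e + f)%N ->
  separated (xvec1 R a b c d e f) (xvec2 R a b c d e f).
Proof.
move=> cd ef.
have [i [x1i x2i]] : exists i, xvec1 R a b c d e f i 0 ^+ 2 = 1 /\ xvec2 R a b c d e f i 0 = 0.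
  have [[i0]|[i0]] := ord_addn_gt0 cd.
    by exists (rshift _ (rshift _ (lshift _ i0)));
      rewrite /xvec1 /xvec2 /col6 !(col_mxEu, col_mxEd) !mxE expr1n.
  by exists (rshift _ (rshift _ (rshift _ (lshift _ i0))));
    rewrite /xvec1 /xvec2 /col6 !(col_mxEu, col_mxEd) !mxE sqrrN expr1n.
have [j [x1j x2j]] : exists j, xvec1 R a b c d e f j 0 = 0 /\ xvec2 R a b c d e f j 0 ^+ 2 = 1.
  have [[j0]|[j0]] := ord_addn_gt0 ef.
    by exists (rshift _ (rshift _ (rshift _ (rshift _ (lshift _ j0)))));
      rewrite /xvec1 /xvec2 /col6 !(col_mxEu, col_mxEd) !mxE expr1n.
  by exists (rshift _ (rshift _ (rshift _ (rshift _ (rshift _ j0)))));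
    rewrite /xvec1 /xvec2 /col6 !(col_mxEu, col_mxEd) !mxE sqrrN expr1n.
by exists i, j.
Qed.

Lemma dot_col_mx m n (u1 v1 : 'cV[R]_m) (u2 v2 : 'cV[R]_n) :
  dot (col_mx u1 u2) (col_mx v1 v2) = dot u1 v1 + dot u2 v2.
Proof. by rewrite /dot tr_col_mx mul_row_col mxE. Qed.

Lemma dotNl n (u v : 'cV[R]_n) : dot (- u) v = - dot u v.
Proof. by rewrite -scaleN1r dotZl mulN1r. Qed.

Lemma dotNr n (u v : 'cV[R]_n) : dot u (- v) = - dot u v.
Proof. by rewrite -scaleN1r dotZr mulN1r. Qed.

Lemma dot0l n (v : 'cV[R]_n) : dot 0 v = 0.
Proof. by rewrite -(scale0r 0) dotZl mul0r. Qed.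

Lemma dot0r n (v : 'cV[R]_n) : dot v 0 = 0.
Proof. by rewrite dotC dot0l. Qed.

Lemma dot_Jmx n : dot (Jmx R n 1) (Jmx R n 1) = n%:R.
Proof. by rewrite /dot tr_Jmx Jmx_mul !mxE mulr1. Qed.

Let dotJE := (dot_col_mx, dotNl, dotNr, dot0l, dot0r, dot_Jmx).

(** The row sums form a combination of [yvec1] and [yvec2] with coefficients the entry sums of
    [xvec1] and [xvec2]; independence makes both vanish. *)
Lemma Emat_row_sums a b c d e f k l p q r s : (0 < k + l)%N -> (0 < p + q)%N ->
  Emat R a b c d e f k l p q r s *m (const_mx 1 : 'cV_(a + (b + (c + (d + (e + f)))))) = 0 ->
  a%:R - b%:R + (c%:R - d%:R) = 0 :> R /\ a%:R - b%:R + (e%:R - f%:R) = 0 :> R.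
Proof.
move=> kl pq; rewrite EmatE mulmxDl -!mulmxA !mul_trmx_dot !mul_mx_scalar.
move=> /(separated_inj (separated_yvec r s kl pq)).
rewrite (_ : const_mx 1 = col6 (Jmx R a 1) (Jmx R b 1) (Jmx R c 1) (Jmx R d 1)
                               (Jmx R e 1) (Jmx R f 1)).
  by rewrite /xvec1 /xvec2 /col6 !dotJE ?(opprK, oppr0, addr0, add0r) => -[x1 x2]; split; lra.
by rewrite /col6 /Jmx !col_mx_const.
Qed.

Lemma MmatE a b c d e f k l p q r s :
  a%:R - b%:R + (c%:R - d%:R) = 0 :> R -> a%:R - b%:R + (e%:R - f%:R) = 0 :> R ->
  k%:R - l%:R + (p%:R - q%:R) = 0 :> R -> k%:R - l%:R + (r%:R - s%:R) = 0 :> R ->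
  let Y := pair_mx (yvec1 k l p q r s) (yvec2 k l p q r s) in
  let X := pair_mx (xvec1 R a b c d e f) (xvec2 R a b c d e f) in
  Mmat R a b c d e f k l p q r s = 4^-1 *: (Y^T *m Y *m (X^T *m X)).
Proof.
move=> abcd abef klpq klrs Y X; apply/matrixP => i j; rewrite [LHS]mxE [RHS]mxE.
rewrite [X in _ = _ * X]mxE !big_ord_recl big_ord0 !mul_trmx_pair_mx /=.
(* The zero-sum relations eliminate [d], [f], [q], [s]; each entry then becomes a polynomial
   identity. *)
have dE : d%:R = a%:R - b%:R + c%:R :> R by lra.
have fE : f%:R = a%:R - b%:R + e%:R :> R by lra.
have qE : q%:R = k%:R - l%:R + p%:R :> R by lra.
have sE : s%:R = k%:R - l%:R + r%:R :> R by lra.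
case: i j => -[|[|//]] ? [[|[|//]] ?] /=;
  rewrite /yvec1 /yvec2 /xvec1 /xvec2 /col6 !dotJE ?(opprK, oppr0, addr0, add0r)
    ?dE ?fE ?qE ?sE; by field.
Qed.

(** As [k + l] is positive, at least one entry exists to reveal [t]. The sign [x] is -1 for the [Y]
    blocks and 1 for the [X] and [Z] blocks. *)
Lemma constant_blocks k l (u : 'cV[R]_k) (v : 'cV[R]_l) (h t x : R) : (0 < k + l)%N ->
  x ^+ 2 = 1 -> (forall i, u i 0 = h + x * t / 2) -> (forall i, v i 0 = h - x * t / 2) ->
  t = 0 <-> u = h *: const_mx 1 /\ v = h *: const_mx 1.
Proof.
move=> kl x1 uE vE; split=> [t0|[uh vh]].
  by split; apply/colP => i; rewrite ?uE ?vE t0 !mxE; ring.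
have xt : x * t = 0.
  case: (ord_addn_gt0 kl) => -[i0].
    by have := uE i0; rewrite uh !mxE => ?; lra.
  by have := vE i0; rewrite vh !mxE => ?; lra.
by rewrite -[t]mul1r -x1 expr2 -mulrA xt mulr0.
Qed.

(** [C] is all ones on the support of [E] and doubles the free blocks elsewhere. So each block row
    of [C x1 = - t y2] or [C x2 = t y1] expresses a signed row sum of a free block as the required
    constant plus or minus [t / 2]. *)
Lemma Amat_row_conditions a b c d e f k l p q r s
  (X11 : 'M[R]_(k, e)) (X12 : 'M[R]_(k, f)) (X21 : 'M[R]_(l, e)) (X22 : 'M[R]_(l, f))
  (Y11 : 'M[R]_(p, c)) (Y12 : 'M[R]_(p, d)) (Y21 : 'M[R]_(q, c)) (Y22 : 'M[R]_(q, d))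
  (Z11 : 'M[R]_(r, a)) (Z12 : 'M[R]_(r, b)) (Z21 : 'M[R]_(s, a)) (Z22 : 'M[R]_(s, b)) :
  let E := Emat R a b c d e f k l p q r s in
  let A := Amat X11 X12 X21 X22 Y11 Y12 Y21 Y22 Z11 Z12 Z21 Z22 in
  let C := A + (A + E) in
  let one n : 'cV[R]_n := const_mx 1 in
  let half (x y : nat) : R := (x%:R - y%:R) / 2 in
  (0 < k + l)%N -> (0 < p + q)%N -> (0 < r + s)%N ->
  a%:R - b%:R + (c%:R - d%:R) = 0 :> R -> a%:R - b%:R + (e%:R - f%:R) = 0 :> R ->
  C *m E^T + (C *m E^T)^T = 0 ->
  [/\ C *m E^T = 0 <-> (X11 *m one e - X12 *m one f = half e f *: one k /\
                        X21 *m one e - X22 *m one f = half e f *: one l),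
      C *m E^T = 0 <-> (Y11 *m one c - Y12 *m one d = half c d *: one p /\
                        Y21 *m one c - Y22 *m one d = half c d *: one q) &
      C *m E^T = 0 <-> (Z11 *m one a - Z12 *m one b = half a b *: one r /\
                        Z21 *m one a - Z22 *m one b = half a b *: one s)].
Proof.
move=> E A C one half kl pq rs abcd abef.
have CE : C *m E^T = C *m xvec1 R a b c d e f *m (yvec1 k l p q r s)^T
                   + C *m xvec2 R a b c d e f *m (yvec2 k l p q r s)^T.
  by rewrite /E EmatE linearD /= !trmx_mul !trmxK mulmxDr !mulmxA.
rewrite CE; move=> /(skew_rank_two (separated_yvec r s kl pq)) [t [Cx1 Cx2 CE0]].
have CA : C = col6
   (row6 (Jmx R k a) (Jmx R k b) (Jmx R k c) (Jmx R k d) (X11 + X11) (X12 + X12))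
   (row6 (Jmx R l a) (Jmx R l b) (Jmx R l c) (Jmx R l d) (X21 + X21) (X22 + X22))
   (row6 (Jmx R p a) (Jmx R p b) (Y11 + Y11) (Y12 + Y12) (Jmx R p e) (Jmx R p f))
   (row6 (Jmx R q a) (Jmx R q b) (Y21 + Y21) (Y22 + Y22) (Jmx R q e) (Jmx R q f))
   (row6 (Z11 + Z11) (Z12 + Z12) (Jmx R r c) (Jmx R r d) (Jmx R r e) (Jmx R r f))
   (row6 (Z21 + Z21) (Z22 + Z22) (Jmx R s c) (Jmx R s d) (Jmx R s e) (Jmx R s f)).
  rewrite /C /A /E /Amat /Emat /col6 /row6 !(add_col_mx, add_row_mx).
  by rewrite !(addr0, add0r, subrr, addrN, addNr, addrK, subrK) ?addrNK.
rewrite {}CA /xvec1 /xvec2 /yvec1 /yvec2 /col6 /row6 !mul_col_mx !mul_row_col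
  !scale_col_mx in Cx1 Cx2.
(* The [Y] and [Z] conditions come from [Cx1], the [X] condition from [Cx2]. *)
move: Cx1 => /eq_col_mx [] _ /eq_col_mx [] _ /eq_col_mx [] Hp /eq_col_mx [] Hq /eq_col_mx [] Hr Hs.
move: Cx2 => /eq_col_mx [] Hk /eq_col_mx [] Hl _.
have entries m (B1 B2 : 'cV[R]_m) : B1 = B2 -> forall i, B1 i 0 = B2 i 0 by move=> ->.
have addE m (B1 B2 : 'cV[R]_m) i : (B1 + B2) i 0 = B1 i 0 + B2 i 0 by rewrite mxE.
have oppE m (B : 'cV[R]_m) i : (- B) i 0 = - B i 0 by rewrite mxE.
have JE m x i : (x *: Jmx R m 1) i 0 = x by rewrite !mxE mulr1.
have zE m (i : 'I_m) : (0 : 'cV[R]_m) i 0 = 0 by rewrite mxE.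
have oneE m : one m = Jmx R m 1 by [].
rewrite !(mulmx0, mulmxN, mulmxDl, Jmx_mul) in Hk Hl Hp Hq Hr Hs.
have {}Hk := entries _ _ _ Hk; have {}Hl := entries _ _ _ Hl.
have {}Hp := entries _ _ _ Hp; have {}Hq := entries _ _ _ Hq.
have {}Hr := entries _ _ _ Hr; have {}Hs := entries _ _ _ Hs.
have unit1 : (1 : R) ^+ 2 = 1 by rewrite expr1n.
have unitN1 : (-1 : R) ^+ 2 = 1 by rewrite sqrrN expr1n.
split; apply: (iff_trans CE0).
- apply: (constant_blocks kl unit1) => i; [have := Hk i | have := Hl i];
    by rewrite !oneE ?(scalerN, addE, oppE, JE, zE) /half => ?; lra.
- apply: (constant_blocks pq unitN1) => i; [have := Hp i | have := Hq i];
    by rewrite !oneE ?(scalerN, addE, oppE, JE, zE) /half => ?; lra.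
- apply: (constant_blocks rs unit1) => i; [have := Hr i | have := Hs i];
    by rewrite !oneE ?(scalerN, addE, oppE, JE, zE) /half => ?; lra.
Qed.

End Blocks.

(** * Gram mates, skew-symmetry and convertibility *)

(** The sum is twice the difference of the two Gram matrices. *)
Lemma equal_gram_skew (R : realType) m n (A E : 'M[R]_(m, n)) :
  A *m A^T = (A + E) *m (A + E)^T ->
  (A + (A + E)) *m E^T + ((A + (A + E)) *m E^T)^T = 0.
Proof.
rewrite trmx_mul trmxK !linearD /= !mulmxDl.
move: (A *m A^T) (A *m E^T) (E *m A^T) (E *m E^T) => W0 W1 W2 W3 WE.
by apply/matrixP => i j; have := congr1 (fun W : 'M_m => W i j) WE; rewrite !mxE => ?; lra.
Qed.

Lemma gram_mates_skew (R : realType) m n (A E : 'M[R]_(m, n)) : gram_mates A (A + E) ->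
  let C := A + (A + E) in
  C *m E^T + (C *m E^T)^T = 0 /\ C^T *m E + (C^T *m E)^T = 0.
Proof.
move=> [_ _ AAT ATA _]; split; first exact: equal_gram_skew.
by rewrite !linearD /= -{2 4}[E]trmxK; apply: equal_gram_skew; rewrite -linearD /= !trmxK.
Qed.

Lemma skew_product_eq0 (R : realType) m n (C E : 'M[R]_(m, n)) :
  C^T *m E + (C^T *m E)^T = 0 -> C *m E^T = 0 -> C^T *m E = 0.
Proof.
move=> /eqP; rewrite addrC addr_eq0 => /eqP skew CE; apply: trmx_mul_eq0.
rewrite skew mulNmx mulmxA -(mulmxA C^T E).
have -> : E *m C^T = 0 by apply: trmx_inj; rewrite trmx_mul trmxK CE trmx0.
by rewrite mulmx0 mul0mx oppr0.
Qed.

Lemma convertible_gram_mates (R : realType) m n (A E : 'M[R]_(m, n)) :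
  gram_mates A (A + E) ->
  let C := A + (A + E) in
  (convertible A (A + E) <-> C *m E^T = 0) /\ (C *m E^T = 0 <-> C^T *m E = 0).
Proof.
move=> gm C; have [skew1 skew2] := gram_mates_skew gm.
have CE : C *m E^T = 0 <-> C^T *m E = 0.
  split; first exact: skew_product_eq0.
  move=> CE; rewrite -[C]trmxK; apply: skew_product_eq0; rewrite !trmxK //.
split=> //; have AE : A != A + E by case: gm => _ _ _ _ /eqP.
apply: (iff_trans (convertible_orthogonal AE)); rewrite /orthogonal_sum_diff -/C.
have -> : A - (A + E) = - E by rewrite opprD addrA subrr sub0r.
split=> [[_ EC]|C0].
  apply: trmx_inj; rewrite trmx_mul trmxK trmx0; apply: oppr_inj.
  by rewrite oppr0 -mulNmx.
split; apply: trmx_inj; rewrite trmx_mul trmxK trmx0 ?trmxK ?linearN /= ?mulmxN.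
  by rewrite (iffLR CE C0) oppr0.
by rewrite C0 oppr0.
Qed.

Unset Implicit Arguments.
Set Strict Implicit.
Set Printing Implicit Defensive.

Theorem theorem4p36 (R : realType) (a b c d e f k l p q r s : nat)
  (X11 : 'M[R]_(k, e)) (X12 : 'M[R]_(k, f)) (X21 : 'M[R]_(l, e)) (X22 : 'M[R]_(l, f))
  (Y11 : 'M[R]_(p, c)) (Y12 : 'M[R]_(p, d)) (Y21 : 'M[R]_(q, c)) (Y22 : 'M[R]_(q, d))
  (Z11 : 'M[R]_(r, a)) (Z12 : 'M[R]_(r, b)) (Z21 : 'M[R]_(s, a)) (Z22 : 'M[R]_(s, b)) :
  (0 < a + b)%N -> (0 < c + d)%N -> (0 < e + f)%N ->
  (0 < k + l)%N -> (0 < p + q)%N -> (0 < r + s)%N ->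
  let m := (k + (l + (p + (q + (r + s)))))%N in
  let n := (a + (b + (c + (d + (e + f)))))%N in
  let E := Emat R a b c d e f k l p q r s in
  let A := Amat X11 X12 X21 X22 Y11 Y12 Y21 Y22 Z11 Z12 Z21 Z22 in
  let M := Mmat R a b c d e f k l p q r s in
  let x1 := xvec1 R a b c d e f in
  let x2 := xvec2 R a b c d e f in
  let one n : 'cV[R]_n := const_mx 1 in
  let half (x y : nat) : R := (x%:R - y%:R) / 2 in
  realizable E ->
  E *m one n = 0 -> (one m)^T *m E = 0 ->
  gram_mates A (A + E) ->
  (convertible A (A + E) <->
     ( (X11 *m one e - X12 *m one f = half e f *: one k /\
         X21 *m one e - X22 *m one f = half e f *: one l)
     \/ (X11^T *m one k - X21^T *m one l = half k l *: one e /\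
         X12^T *m one k - X22^T *m one l = half k l *: one f)
     \/ (Y11 *m one c - Y12 *m one d = half c d *: one p /\
         Y21 *m one c - Y22 *m one d = half c d *: one q)
     \/ (Y11^T *m one p - Y21^T *m one q = half p q *: one c /\
         Y12^T *m one p - Y22^T *m one q = half p q *: one d)
     \/ (Z11 *m one a - Z12 *m one b = half a b *: one r /\
         Z21 *m one a - Z22 *m one b = half a b *: one s)
     \/ (Z11^T *m one r - Z21^T *m one s = half r s *: one a /\
         Z12^T *m one r - Z22^T *m one s = half r s *: one b)))
  /\
  (convertible A (A + E) ->
     (* the Gram singular values (w.r.t. any witnessing decomposition)
        are exactly the square roots of the eigenvalues of M *)
     (forall U V Sg S, conv_data A (A + E) U V Sg S ->
        (forall (i : 'I_m) (j : 'I_n), (i : nat) = j -> S i i = -1 ->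
           exists2 lam, eigenval M lam & Sg i j = Num.sqrt lam) /\
        (forall lam, eigenval M lam ->
           exists (i : 'I_m) (j : 'I_n), [/\ (i : nat) = j, S i i = -1 & Sg i j = Num.sqrt lam]))
     /\
     (* the normalization of zeta_1 x_1 + zeta_2 x_2 is a right singular
        vector associated with sqrt lam *)
     (forall lam (z : 'cV[R]_2), eigenpair M lam z ->
        exists U V Sg S (i : 'I_m) (j : 'I_n),
          [/\ conv_data A (A + E) U V Sg S, (i : nat) = j, S i i = -1,
              Sg i j = Num.sqrt lam &
              col j V = normalize (z ord0 ord0 *: x1 + z ord_max ord0 *: x2)])).
Proof.
move=> ab cd ef kl pq rs m n E A M x1 x2 one half _ E1 E1T gm.
have [abcd abef] := Emat_row_sums kl pq E1.
have [klpq klrs] : k%:R - l%:R + (p%:R - q%:R) = 0 :> R /\ k%:R - l%:R + (r%:R - s%:R) = 0 :> R.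
  (* Column sums of [E] are row sums of its transpose, which has the same block pattern. *)
  apply: (@Emat_row_sums R k l p q r s a b c d e f) => //.
  by rewrite -tr_Emat; apply: trmx_inj; rewrite trmx_mul trmxK trmx0.
have [conv CEeq] := convertible_gram_mates gm.
have [skew1 skew2] := gram_mates_skew gm.
have [ci ciii cv] := Amat_row_conditions kl pq rs abcd abef skew1.
have CT : (A + (A + E))^T = A^T + (A^T + E^T) by rewrite !linearD.
have [cvi civ cii] :
  [/\ (A + (A + E))^T *m E = 0 <-> (Z11^T *m one r - Z21^T *m one s = half r s *: one a /\
         Z12^T *m one r - Z22^T *m one s = half r s *: one b),
      (A + (A + E))^T *m E = 0 <-> (Y11^T *m one p - Y21^T *m one q = half p q *: one c /\
         Y12^T *m one p - Y22^T *m one q = half p q *: one d) &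
      (A + (A + E))^T *m E = 0 <-> (X11^T *m one k - X21^T *m one l = half k l *: one e /\
         X12^T *m one k - X22^T *m one l = half k l *: one f)].
  have := @Amat_row_conditions R k l p q r s a b c d e f Z11^T Z21^T Z12^T Z22^T
    Y11^T Y21^T Y12^T Y22^T X11^T X21^T X12^T X22^T ab cd ef klpq klrs.
  by rewrite -tr_Amat -tr_Emat -/A -/E trmxK -CT; apply.
split.
  split=> [/conv/ci ?|]; first by left.
  case=> [/ci ?|[/cii ?|[/ciii ?|[/civ ?|[/cv ?|/cvi ?]]]]]; apply/conv => //;
    exact/CEeq.
move=> cAE.
pose Y := pair_mx (yvec1 R k l p q r s) (yvec2 R k l p q r s).
pose X := pair_mx x1 x2.
have ME : M = 4^-1 *: (Y^T *m Y *m (X^T *m X)) by apply: MmatE.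
have EYX : A + E - A = Y *m X^T by rewrite addrC addKr mul_pair_mxT; apply: EmatE.
have Xinj := pair_mx_inj (separated_xvec R a b cd ef).
have Yinj := pair_mx_inj (separated_yvec R r s kl pq).
split.
  move=> U V Sg S cdata; split=> [i j ij Si|lam [z zM]].
    have [Sg0 Vj EV EU] := conv_data_triple cdata ij Si; rewrite EYX in EV EU.
    have mu0 : - 2 * Sg i j != 0 by rewrite mulf_neq0 ?oppr_eq0 ?pnatr_eq0 // gt_eqF.
    have := eigenval_of_triple mu0 Vj EV EU; rewrite -ME => eig.
    (* The singular value of [E] carries a factor -2, and squaring and dividing by 4 removes it. *)
    exists ((- 2 * Sg i j) ^+ 2 / 4) => //.
    rewrite (_ : _ / 4 = Sg i j ^+ 2); last by field.
    by rewrite sqrtr_sqr gtr0_norm.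
  rewrite ME in zM; have [lam0 Xz EXz] := eigenpair_factored Xinj Yinj zM.
  by rewrite -EYX in EXz; apply: conv_data_eigen cdata lam0 Xz EXz.
move=> lam z zM; rewrite ME in zM; have [lam0 Xz EXz] := eigenpair_factored Xinj Yinj zM.
rewrite -EYX in EXz; rewrite -mul_pair_mx -/X.
(* Only the orthogonality relations are kept from the given decomposition; a new one is built around
   the prescribed vector. *)
have [U [V [Sg [S /conv_data_orthogonal orth]]]] := cAE.
apply: conv_data_prescribed => //; first exact: dot_normalize.
by rewrite normalize_dot -!scalemxAr EXz !scalerA mulrC.
Qed.
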